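(* Let $T_h$ be a triangle one of whose heights is $h$. Suppose $X\subseteq\mathbb{E}^n$ satisfies $\mathbb{S}^{n-2}(h)\overset{2}{\rightarrow}X$. Then for any positive integer $r$, we have $\mathbb{E}^n\overset{r}{\rightarrow}(X;T_h)_{\mathrm{GR}}$.
   Context: $\mathbb{E}^n$ denotes $n$-dimensional Euclidean space. An $r$-coloring of a set of points is an assignment to each of its points of one of $r$ colors (not all colors need be used). A set of points is monochromatic if all its points have the same color, and rainbow if its points have pairwise distinct colors. Triangles are identified with their sets of three (non-collinear) vertices. A triangle has height $h$ if its vertices can be labelled $\boldsymbol{a},\boldsymbol{b},\boldsymbol{c}$ so that the distance from $\boldsymbol{c}$ to the line $\boldsymbol{ab}$ is $h$. $\mathbb{S}^{d}(h)$ denotes the $d$-dimensional sphere (surface) of radius $h$, i.e. the set of points at distance $h$ from a fixed center in $\mathbb{E}^{d+1}$. $\mathbb{S}^{d}(h)\overset{r}{\rightarrow}X$ means that every $r$-coloring of $\mathbb{S}^d(h)$ contains a monochromatic set congruent (isometric) to $X$. $\mathbb{E}^n\overset{r}{\rightarrow}(K_1;K_2)_{\mathrm{GR}}$ means that every $r$-coloring of $\mathbb{E}^n$ contains either a monochromatic set congruent to $K_1$ or a rainbow set congruent to $K_2$. Here $n\ge 2$, so that $\mathbb{S}^{n-2}(h)$ is defined. *)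

(* Defs.v *)
From mathcomp Require Import all_boot all_order all_algebra.
From mathcomp Require Import all_classical all_reals.

Set Implicit Arguments.
Unset Strict Implicit.
Unset Printing Implicit Defensive.

Import Order.TTheory GRing.Theory Num.Theory.

Local Open Scope classical_set_scope.
Local Open Scope ring_scope.

(* The norm that MathComp-Analysis puts on row vectors is the sup norm, so the
   Euclidean distance is defined here. *)
Definition eucl_dist (R : realType) (n : nat) (x y : 'rV[R]_n) : R :=
  Num.sqrt (\sum_(i < n) (x 0 i - y 0 i) ^+ 2).

Definition congruent (R : realType) (m n : nat)
    (A : set 'rV[R]_m) (B : set 'rV[R]_n) : Prop :=
  exists2 f : 'rV[R]_m -> 'rV[R]_n, set_bij A B f &
    forall x y, A x -> A y -> eucl_dist (f x) (f y) = eucl_dist x y.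

(* The sphere of dimension d; it lies in the space of dimension d + 1. *)
Definition sphere (R : realType) (d : nat) (c : 'rV[R]_d.+1) (h : R) :
    set 'rV[R]_d.+1 :=
  [set x | eucl_dist x c = h].

Definition line (R : realType) (n : nat) (a b : 'rV[R]_n) : set 'rV[R]_n :=
  [set a + t *: (b - a) | t in [set: R]].

Definition dist_line (R : realType) (n : nat) (c a b : 'rV[R]_n) : R :=
  inf [set eucl_dist c x | x in line a b].

Definition collinear (R : realType) (n : nat) (A : set 'rV[R]_n) : Prop :=
  exists a b : 'rV[R]_n, a <> b /\ A `<=` line a b.

Definition triangle (R : realType) (n : nat) (T : set 'rV[R]_n) : Prop :=
  (exists a b c : 'rV[R]_n, T = [set a; b; c]) /\ ~ collinear T.

(* When T is a triangle, the labels a, b, c are necessarily distinct, since a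
   set of at most two points is collinear (for n > 0). *)
Definition has_height (R : realType) (n : nat) (T : set 'rV[R]_n) (h : R) :
    Prop :=
  exists a b c : 'rV[R]_n, T = [set a; b; c] /\ dist_line c a b = h.

Definition monochromatic (R : realType) (n r : nat)
    (chi : 'rV[R]_n -> 'I_r) (A : set 'rV[R]_n) : Prop :=
  forall x y, A x -> A y -> chi x = chi y.

Definition rainbow (R : realType) (n r : nat)
    (chi : 'rV[R]_n -> 'I_r) (A : set 'rV[R]_n) : Prop :=
  set_inj A chi.

(* A coloring of S is given by a coloring of the whole space, whose values
   outside S are irrelevant; for r > 0 every coloring of S extends to one. *)
Definition arrow (R : realType) (m n r : nat)
    (S : set 'rV[R]_m) (X : set 'rV[R]_n) : Prop :=
  forall chi : 'rV[R]_m -> 'I_r,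
    exists Y : set 'rV[R]_m,
      [/\ Y `<=` S, congruent Y X & monochromatic chi Y].

Definition GR_arrow (R : realType) (n r : nat)
    (K1 K2 : set 'rV[R]_n) : Prop :=
  forall chi : 'rV[R]_n -> 'I_r,
    (exists2 Y : set 'rV[R]_n, congruent Y K1 & monochromatic chi Y) \/
    (exists2 Y : set 'rV[R]_n, congruent Y K2 & rainbow chi Y).

(* Main.v *)
Require Import Defs.
From mathcomp Require Import all_boot all_order all_algebra.
From mathcomp Require Import all_classical all_reals.
From mathcomp Require Import ring lra.

Set Implicit Arguments.
Unset Strict Implicit.
Unset Printing Implicit Defensive.

Import Order.TTheory GRing.Theory Num.Theory.

Local Open Scope classical_set_scope.
Local Open Scope ring_scope.

(** Let A, B, C be the vertices of T, with C at distance h from the line AB,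
    and let d be the distance from A to B.

    If every two points at distance d have the same color, then the whole space
    has one color, because in dimension at least 2 any two points are joined by
    a chain of steps of length d ([step_monochromatic]); X itself is then
    monochromatic.

    Otherwise some a, b at distance d have different colors.  Rotating T about
    its side AB, moved onto ab, sends C around a sphere of dimension n - 2 and
    radius h, which lies in the hyperplane orthogonal to ab through the foot of
    the height.  Each point x of this sphere spans with a, b a triangle
    congruent to T, so, if there is no rainbow copy of T, x has the color of a
    or the color of b.  The sphere is thus 2-colored and the hypothesis gives
    a monochromatic copy of X on it.

    The sphere of the hypothesis lives in a space of dimension n - 1, and
    [hyperplane_frame] supplies the isometric embedding of that space onto
    the hyperplane.  The same lemma gives the perpendicular directions that
    build the steps of length d in [step_monochromatic]. *)

(** * The Euclidean inner product *)

Definition dot (R : realType) (n : nat) (u v : 'rV[R]_n) : R :=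
  (u *m v^T) 0 0.

Lemma dotC (R : realType) (n : nat) (u v : 'rV[R]_n) : dot u v = dot v u.
Proof. by rewrite /dot -[u *m v^T]trmxK trmx_mul trmxK mxE. Qed.

Lemma dotDl (R : realType) (n : nat) (u v w : 'rV[R]_n) :
  dot (u + v) w = dot u w + dot v w.
Proof. by rewrite /dot mulmxDl mxE. Qed.

Lemma dotZl (R : realType) (n : nat) (t : R) (u v : 'rV[R]_n) :
  dot (t *: u) v = t * dot u v.
Proof. by rewrite /dot -scalemxAl mxE. Qed.

Lemma dotNl (R : realType) (n : nat) (u v : 'rV[R]_n) :
  dot (- u) v = - dot u v.
Proof. by rewrite /dot mulNmx mxE. Qed.

Lemma dotDr (R : realType) (n : nat) (u v w : 'rV[R]_n) :
  dot u (v + w) = dot u v + dot u w.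
Proof. by rewrite !(dotC u) dotDl. Qed.

Lemma dotZr (R : realType) (n : nat) (t : R) (u v : 'rV[R]_n) :
  dot u (t *: v) = t * dot u v.
Proof. by rewrite !(dotC u) dotZl. Qed.

Lemma dotNr (R : realType) (n : nat) (u v : 'rV[R]_n) :
  dot u (- v) = - dot u v.
Proof. by rewrite !(dotC u) dotNl. Qed.

Definition dotE := (dotDl, dotDr, dotZl, dotZr, dotNl, dotNr).

Lemma dot_sum (R : realType) (n : nat) (u v : 'rV[R]_n) :
  dot u v = \sum_(i < n) u 0 i * v 0 i.
Proof. by rewrite /dot mxE; apply: eq_bigr => i _; rewrite mxE. Qed.

Lemma dot_ge0 (R : realType) (n : nat) (u : 'rV[R]_n) : 0 <= dot u u.
Proof. by rewrite dot_sum sumr_ge0 // => i _; rewrite -expr2 sqr_ge0. Qed.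

Lemma dot_eq0 (R : realType) (n : nat) (u : 'rV[R]_n) :
  (dot u u == 0) = (u == 0).
Proof.
apply/eqP/eqP => [|->]; last by rewrite /dot mul0mx mxE.
rewrite dot_sum => /eqP; rewrite psumr_eq0 => [|i _]; last first.
  by rewrite -expr2 sqr_ge0.
move=> /allP u0; apply/rowP => i; rewrite mxE; apply/eqP.
by have := u0 i (mem_index_enum _); rewrite -expr2 sqrf_eq0.
Qed.

Lemma eucl_distE (R : realType) (n : nat) (x y : 'rV[R]_n) :
  eucl_dist x y = Num.sqrt (dot (x - y) (x - y)).
Proof.
rewrite /eucl_dist dot_sum; congr Num.sqrt.
by apply: eq_bigr => i _; rewrite !mxE expr2.
Qed.

Lemma eucl_dist_eq0 (R : realType) (n : nat) (x y : 'rV[R]_n) :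
  eucl_dist x y = 0 -> x = y.
Proof.
move=> /eqP; rewrite eucl_distE sqrtr_eq0 => le0.
by apply/eqP; rewrite -subr_eq0 -dot_eq0 eq_le le0 dot_ge0.
Qed.

Lemma eucl_distC (R : realType) (n : nat) (x y : 'rV[R]_n) :
  eucl_dist x y = eucl_dist y x.
Proof. by rewrite !eucl_distE -opprB dotNl dotNr opprK. Qed.

Lemma eucl_distxx (R : realType) (n : nat) (x : 'rV[R]_n) : eucl_dist x x = 0.
Proof.
by apply/eqP; rewrite eucl_distE sqrtr_eq0 subrr /dot mul0mx mxE.
Qed.

(** * Orthonormal frames of hyperplanes *)

(** The rows of [N] are an orthonormal basis of the hyperplane orthogonal to
    [v] (of some hyperplane, if [v] is zero).  A Householder reflection [H]
    exchanges [v] with a multiple of the first basis vector [e], so it carries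
    the other basis vectors, the rows of [J], to the required ones. *)
Lemma hyperplane_frame (R : realType) (m : nat) (v : 'rV[R]_m.+1) :
  exists N : 'M[R]_(m, m.+1), N *m N^T = 1%:M /\ N *m v^T = 0.
Proof.
pose e : 'rV[R]_(1 + m) := row_mx 1%:M 0.
pose J : 'M[R]_(m, 1 + m) := row_mx 0 1%:M.
pose s := Num.sqrt (dot v v); pose z := v - s *: e.
have JJ : J *m J^T = 1%:M.
  by rewrite /J tr_row_mx mul_row_col mul0mx add0r trmx1 mulmx1.
have Je : J *m e^T = 0.
  by rewrite /J /e tr_row_mx mul_row_col mul0mx add0r trmx0 mulmx0.
have ee : dot e e = 1.
  by rewrite /dot /e tr_row_mx mul_row_col mul0mx addr0 trmx1 mulmx1 mxE.
have ss : s ^+ 2 = dot v v by rewrite sqr_sqrtr ?dot_ge0.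
have [z0|z0] := eqVneq z 0.
  (* Here v is already a multiple of e, and there is nothing to reflect. *)
  exists J; split => //.
  have -> : v = s *: e by apply/eqP; rewrite -subr_eq0; apply/eqP.
  by rewrite linearZ /= -scalemxAr Je scaler0.
have zz0 : dot z z != 0 by rewrite dot_eq0.
(* This holds because v and s e have the same length; it makes the reflection
   along z send v to v - z = s e. *)
have zv : dot z v = dot z z / 2.
  have : dot z z = 2 * dot z v.
    by rewrite /z !dotE ee -ss (dotC e v); ring.
  by move=> ->; field.
pose H : 'M[R]_(1 + m) := 1%:M - (2 / dot z z) *: (z^T *m z).
have mxdot (u w : 'rV[R]_(1 + m)) : u *m w^T = (dot u w)%:M.
  by apply/matrixP => i j; rewrite !ord1 /dot [RHS]mxE eqxx mulr1n.
have HT : H^T = H.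
  by rewrite /H linearB /= trmx1 linearZ /= trmx_mul trmxK.
have HH : H *m H = 1%:M.
  rewrite {2}/H mulmxBr mulmx1 -scalemxAr /H mulmxBl mul1mx -scalemxAl.
  rewrite -mulmxA (mulmxA z) mxdot mul_scalar_mx -scalemxAr !scalerBr !scalerA.
  rewrite (_ : 2 / dot z z * (2 / dot z z) * dot z z
             = 2 / dot z z + 2 / dot z z); last by field.
  rewrite scalerDl; move: ((2 / _) *: _) => A.
  by apply/matrixP => i j; rewrite !mxE; ring.
have Hv : H *m v^T = s *: e^T.
  rewrite /H mulmxBl mul1mx -scalemxAl -mulmxA mxdot zv mul_mx_scalar scalerA.
  rewrite (_ : 2 / dot z z * _ = 1); last by field.
  by rewrite scale1r /z linearB /= linearZ /= opprB addrC subrK.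
exists (J *m H); split.
  by rewrite trmx_mul HT mulmxA -(mulmxA J) HH mulmx1.
by rewrite -mulmxA Hv -scalemxAr Je scaler0.
Qed.

Lemma dot_frame (R : realType) (m n : nat) (N : 'M[R]_(m, n)) (x y : 'rV_m) :
  N *m N^T = 1%:M -> dot (x *m N) (y *m N) = dot x y.
Proof.
by move=> NN; rewrite /dot trmx_mul mulmxA -(mulmxA x) NN mulmx1.
Qed.

Lemma dot_frame_orth (R : realType) (m n : nat) (N : 'M[R]_(m, n))
    (x : 'rV_m) (v : 'rV_n) :
  N *m v^T = 0 -> dot (x *m N) v = 0.
Proof. by move=> Nv; rewrite /dot -mulmxA Nv mulmx0 mxE. Qed.

(** * Chains of steps of equal length *)

(** A segment of length at most [2 * d] is the base of an isosceles triangle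
    with legs [d], so its ends have the color of the apex.  Cut the segment
    from [x] to [y] into [M.+1] equal parts that are short enough: all
    subdivision points have the same color. *)
Lemma step_monochromatic (R : realType) (k : nat) (C : Type)
    (chi : 'rV[R]_k.+2 -> C) (d : R) :
    0 < d -> (forall x y, eucl_dist x y = d -> chi x = chi y) ->
  forall x y, chi x = chi y.
Proof.
move=> d0 step x y.
have [M leM] : exists M : nat, dot (y - x) (y - x) <= 4 * d ^+ 2 * M.+1%:R.
  exists (Num.bound (dot (y - x) (y - x) / (4 * d ^+ 2))).
  have d4 : 0 < 4 * d ^+ 2 by rewrite mulr_gt0 // exprn_gt0.
  rewrite -ler_pdivrMl // mulrC.
  have ge0 : 0 <= dot (y - x) (y - x) / (4 * d ^+ 2).
    by rewrite divr_ge0 ?dot_ge0 // ltW.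
  apply: le_trans (ltW (archi_boundP ge0)) _.
  by rewrite ler_nat.
pose v : 'rV[R]_k.+2 := M.+1%:R^-1 *: (y - x).
have M1 : 1 <= M.+1%:R :> R by rewrite ler1n.
have M0 : M.+1%:R != 0 :> R by rewrite pnatr_eq0.
have vv : dot v v <= 4 * d ^+ 2.
  have -> : dot v v = dot (y - x) (y - x) / M.+1%:R / M.+1%:R.
    by rewrite /v dotZl dotZr; field; rewrite nat1r.
  have Mp : 0 < M.+1%:R :> R by rewrite ltr0n.
  rewrite !ler_pdivrMr //; apply: le_trans leM _.
  by rewrite ler_peMr // !mulr_ge0 // ?exprn_ge0 // ltW.
have vM : v *+ M.+1 = y - x.
  by rewrite /v -scaler_nat scalerA divff // scale1r.
clearbody v.
have [N [NN Nv]] := hyperplane_frame v.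
(* The apex over a base p, p + v is p + v / 2 + w; Pythagoras gives the length
   of w. *)
pose e : 'rV[R]_k.+1 := delta_mx 0 0.
pose w : 'rV[R]_k.+2 := Num.sqrt (d ^+ 2 - dot v v / 4) *: (e *m N).
have wv : dot w v = 0 by rewrite dotZl dot_frame_orth // mulr0.
have ww : dot w w = d ^+ 2 - dot v v / 4.
  have e1 : dot e e = 1.
    by rewrite /dot trmx_delta mul_delta_mx mxE.
  rewrite /w; set q := _ - _; have q0 : 0 <= q by rewrite /q; lra.
  by rewrite dotZl dotZr dot_frame // e1 mulr1 -expr2 sqr_sqrtr.
clearbody w.
have apex p : chi p = chi (p + v).
  have dd : d = Num.sqrt (d ^+ 2) by rewrite sqrtr_sqr gtr0_norm.
  transitivity (chi (p + 2^-1 *: v + w)); apply: step.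
    rewrite eucl_distC eucl_distE dd; congr Num.sqrt.
    have -> : p + 2^-1 *: v + w - p = 2^-1 *: v + w.
      by rewrite -!addrA (addrC p) !addrA addrNK.
    by rewrite !dotE ww (dotC v w) wv; field.
  rewrite eucl_distE dd; congr Num.sqrt.
  have -> : p + 2^-1 *: v + w - (p + v) = w - 2^-1 *: v.
    have {2}-> : v = 2^-1 *: v + 2^-1 *: v.
      by rewrite -scalerDl [X in X *: _](_ : _ = 1) ?scale1r //; field.
    rewrite opprD opprD; apply/rowP => i; rewrite !mxE; ring.
  by rewrite !dotE ww (dotC v w) wv; field.
have chain i : chi x = chi (x + v *+ i).
  elim: i => [|i ->]; first by rewrite mulr0n addr0.
  by rewrite apex -addrA mulrSr.
by rewrite (chain M.+1) vM addrC subrK.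
Qed.

(** * Congruence *)

Lemma isometric_inj (R : realType) (m n : nat) (A : set 'rV[R]_m)
    (f : 'rV[R]_m -> 'rV[R]_n) :
    (forall x y, A x -> A y -> eucl_dist (f x) (f y) = eucl_dist x y) ->
  set_inj A f.
Proof.
move=> iso x y /set_mem Ax /set_mem Ay fxy; apply: eucl_dist_eq0.
by rewrite -iso // fxy eucl_distxx.
Qed.

(** The side-side-side criterion.  Distinctness of the first triple makes the
    vertex-to-vertex map a well-defined function, and equality of the sides
    makes it injective. *)
Lemma congruent_triple (R : realType) (m n : nat)
    (a b c : 'rV[R]_m) (a' b' c' : 'rV[R]_n) :
    a != b -> c != a -> c != b ->
    eucl_dist a' b' = eucl_dist a b -> eucl_dist c' a' = eucl_dist c a ->
    eucl_dist c' b' = eucl_dist c b ->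
  congruent [set a; b; c] [set a'; b'; c'].
Proof.
move=> ab ca cb dab dca dcb.
pose f x := if x == a then a' else if x == b then b' else c'.
have fa : f a = a' by rewrite /f eqxx.
have fb : f b = b' by rewrite /f eq_sym (negbTE ab) eqxx.
have fc : f c = c' by rewrite /f (negbTE ca) (negbTE cb).
have iso x y : [set a; b; c] x -> [set a; b; c] y ->
    eucl_dist (f x) (f y) = eucl_dist x y.
  by move=> [[|]|] -> [[|]|] ->; rewrite ?fa ?fb ?fc ?eucl_distxx //
    eucl_distC ?dab ?dca ?dcb eucl_distC.
exists f => //; split.
- by move=> x [[|]|] ->; rewrite ?fa ?fb ?fc; [left; left|left; right|right].
- exact: isometric_inj iso.
- by move=> y [[|]|] ->; [exists a|exists b|exists c] => //;
    [left; left|left; right|right].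
Qed.

Lemma congruent_image (R : realType) (l m n : nat)
    (Y : set 'rV[R]_m) (X : set 'rV[R]_n) (g : 'rV[R]_m -> 'rV[R]_l) :
    (forall x y, eucl_dist (g x) (g y) = eucl_dist x y) ->
  congruent Y X -> congruent (g @` Y) X.
Proof.
move=> giso [f [fYX finj fsurj] fiso].
pose g' z := xget 0 [set y | g y = z].
have gK y : g' (g y) = y.
  have gg' : g (g' (g y)) = g y.
    by apply: (@xgetPex _ 0 [set x | g x = g y]); exists y.
  by apply: eucl_dist_eq0; rewrite -giso gg' eucl_distxx.
have iso x y : (g @` Y) x -> (g @` Y) y ->
    eucl_dist (f (g' x)) (f (g' y)) = eucl_dist x y.
  by move=> [x' Yx <-] [y' Yy <-]; rewrite !gK fiso // giso.
exists (f \o g') => //; split.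
- by move=> _ [y Yy <-] /=; rewrite gK; apply: fYX.
- exact: isometric_inj iso.
- by move=> x /fsurj[y Yy <-]; exists (g y) => /=; [exists y|rewrite gK].
Qed.

(** * The foot of a height *)

(** The foot of the perpendicular from [c] to the line [ab] is
    [a + foot_coord c a b *: (b - a)]; keeping its coordinate on the line makes
    it possible to reproduce the same configuration on another pair of points
    at the same distance. *)
Definition foot_coord (R : realType) (n : nat) (c a b : 'rV[R]_n) : R :=
  dot (c - a) (b - a) / dot (b - a) (b - a).

Lemma foot_orth (R : realType) (n : nat) (c a b : 'rV[R]_n) : a != b ->
  dot (c - (a + foot_coord c a b *: (b - a))) (b - a) = 0.
Proof.
rewrite eq_sym -subr_eq0 -dot_eq0 => ab.
by rewrite opprD addrA dotDl dotNl dotZl /foot_coord divfK // subrr.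
Qed.

(** By Pythagoras the foot is the point of the line closest to [c], so the
    infimum that defines the distance is attained there. *)
Lemma dist_lineE (R : realType) (n : nat) (c a b : 'rV[R]_n) : a != b ->
  dist_line c a b = eucl_dist c (a + foot_coord c a b *: (b - a)).
Proof.
move=> ab; set t := foot_coord c a b; set p := a + _.
have orth : dot (c - p) (b - a) = 0 by exact: foot_orth.
have least s : eucl_dist c p <= eucl_dist c (a + s *: (b - a)).
  rewrite !eucl_distE ler_sqrt ?dot_ge0 //.
  have -> : c - (a + s *: (b - a)) = (c - p) + (t - s) *: (b - a).
    by rewrite /p; apply/rowP => i; rewrite !mxE; ring.
  move: (c - p) (b - a) orth => q u qu.
  rewrite dotDl !dotDr !dotZl !dotZr (dotC u) qu !mulr0.
  by rewrite addr0 add0r lerDl mulrA mulr_ge0 ?dot_ge0 // -expr2 sqr_ge0.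
have lb : lbound [set eucl_dist c x | x in line a b] (eucl_dist c p).
  by move=> _ [_ [s _ <-] <-].
have pin : [set eucl_dist c x | x in line a b] (eucl_dist c p).
  by exists p => //; exists t.
apply/eqP; rewrite eq_le; apply/andP; split.
  by apply: ge_inf => //; exists (eucl_dist c p).
by apply: lb_le_inf => //; exists (eucl_dist c p).
Qed.

(** This rules out a triangle whose labels [a] and [b] coincide.  When [c] is
    equal to [a] as well, any line through [a] will do; it exists because the
    dimension is positive. *)
Lemma pair_collinear (R : realType) (n : nat) (a c : 'rV[R]_n.+1) :
  collinear [set a; a; c].
Proof.
have on_line (b : 'rV[R]_n.+1) : line a b a /\ line a b b.
  split; first by exists 0 => //; rewrite scale0r addr0.
  by exists 1 => //; rewrite scale1r addrC subrK.
have [ac|ac] := eqVneq a c.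
  exists a, (a + delta_mx 0 0); split.
    move=> /eqP; rewrite -subr_eq0 opprD addrA subrr sub0r oppr_eq0.
    by move=> /eqP/rowP/(_ 0)/eqP; rewrite !mxE !eqxx oner_eq0.
  by move=> x [[|]|] ->; rewrite -?ac; apply: (on_line _).1.
exists a, c; split; first exact/eqP.
by move=> x [[|]|] ->; [apply: (on_line _).1..|apply: (on_line _).2].
Qed.

(** * The Gallai-Ramsey property *)

(** The argument described at the top, with the dimension written as [k.+2] so
    that the ambient space of the sphere is the one that
    [hyperplane_frame] embeds. *)
Lemma GR_arrow_of_sphere (R : realType) (k : nat) (h : R)
    (T X : set 'rV[R]_k.+2) (c : 'rV[R]_k.+1) (r : nat) :
  triangle T -> has_height T h -> arrow 2 (sphere c h) X -> GR_arrow r X T.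
Proof.
move=> [_ nonc] [A [B [C [TE hE]]]] hX chi.
have AB : A != B.
  by apply: contra_notN nonc => /eqP AB; rewrite TE -AB; apply: pair_collinear.
set t := foot_coord C A B; pose P := A + t *: (B - A).
have CP : dot (C - P) (B - A) = 0 by exact: foot_orth.
have {}hE : eucl_dist C P = h by rewrite -hE dist_lineE.
have d0 : 0 < eucl_dist A B.
  by rewrite lt0r eucl_distE sqrtr_ge0 -eucl_distE andbT;
     apply: contra_neq AB => /eucl_dist_eq0.
have [[a [b [dab cab]]]|same] :=
  pselect (exists a b, eucl_dist a b = eucl_dist A B /\ chi a <> chi b);
  last first.
  have const := @step_monochromatic R k _ chi _ d0.
  left; exists X; last first.
    move=> x y _ _; apply: const => {}x {}y dxy.
    by apply: contrapT => cxy; apply: same; exists x, y.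
  by exists id => //; split => // x Xx; exists x.
have [rb|norb] := pselect
    (exists2 Y : set 'rV[R]_k.+2, congruent Y T & rainbow chi Y).
  by right.
left.
have [N [NN Nv]] := hyperplane_frame (b - a).
(* The map g takes the sphere centered at c to the sphere swept by C, centered
   at p, the point of the line ab that corresponds to P. *)
pose p := a + t *: (b - a); pose g x := p + (x - c) *m N.
have giso x y : eucl_dist (g x) (g y) = eucl_dist x y.
  rewrite !eucl_distE -(dot_frame (x - y) (x - y) NN) /g.
  by rewrite opprD addrACA subrr add0r -mulmxBl opprB addrA subrK.
(* The points g x and C lie in the same position with respect to the lines ab
   and AB; s = 0 and s = 1 give the sides at a and at b. *)
have apart (s : R) x : sphere c h x ->
    eucl_dist (g x) (a + s *: (b - a)) = eucl_dist C (A + s *: (B - A)).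
  move=> /= hx.
  have sq (u w : 'rV[R]_k.+2) : dot (u - w) (u - w) = eucl_dist u w ^+ 2.
    by rewrite eucl_distE sqr_sqrtr ?dot_ge0.
  have xx : dot (x - c) (x - c) = dot (C - P) (C - P).
    by rewrite sq hE -hx eucl_distE sqr_sqrtr ?dot_ge0.
  have bb : dot (b - a) (b - a) = dot (B - A) (B - A).
    by rewrite !sq eucl_distC dab eucl_distC.
  rewrite !eucl_distE; congr Num.sqrt.
  have -> : g x - (a + s *: (b - a)) = (x - c) *m N + (t - s) *: (b - a).
    by rewrite /g /p; move: (_ *m _) => w; apply/rowP => i; rewrite !mxE; ring.
  have -> : C - (A + s *: (B - A)) = (C - P) + (t - s) *: (B - A).
    by rewrite /P; apply/rowP => i; rewrite !mxE; ring.
  have orth : dot ((x - c) *m N) (b - a) = 0 by exact: dot_frame_orth.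
  have {}xx : dot ((x - c) *m N) ((x - c) *m N) = dot (C - P) (C - P).
    by rewrite dot_frame.
  move: (C - P) (B - A) (_ *m N) (b - a) CP xx bb orth => Q U q u QU qq uu qu.
  by rewrite !dotE (dotC u) (dotC U) QU qu qq uu; ring.
have two x : sphere c h x -> chi (g x) <> chi a -> chi (g x) = chi b.
  move=> hx cxa; apply: contrapT => cxb; apply: norb.
  exists [set a; b; g x].
    rewrite TE; apply: congruent_triple.
    - by apply: contra_notN cab => /eqP ->.
    - by apply: contra_notN cxa => /eqP ->.
    - by apply: contra_notN cxb => /eqP ->.
    - by [].
    - by have := apart 0 x hx; rewrite !scale0r !addr0.
    - by have := apart 1 x hx; rewrite !scale1r !(addrC _ (_ - _)) !subrK.
  move=> y z /set_mem[[|]|] -> /set_mem[[|]|] -> //;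
    by move=> /esym.
have [Y [YS YX Ymono]] :=
  hX (fun x => if chi (g x) == chi a then ord0 else ord_max).
exists (g @` Y); first exact: congruent_image YX.
move=> _ _ [x Yx <-] [y Yy <-].
have := Ymono x y Yx Yy.
have [->|/eqP xa] := eqVneq; have [->|/eqP ya] := eqVneq => // _.
by rewrite (two x (YS x Yx) xa) (two y (YS y Yy) ya).
Qed.

Theorem theorem1p3 (R : realType) (n : nat) (hn : (2 <= n)%N)
    (h : R) (T : set 'rV[R]_n) (hT : triangle T) (hTh : has_height T h)
    (c : 'rV[R]_(n - 2).+1) (X : set 'rV[R]_n)
    (hX : arrow 2 (sphere c h) X) (r : nat) (hr : (0 < r)%N) :
  GR_arrow r X T.
Proof.
case: n hn T hT hTh c X hX => [|[|k]] // _ T hT hTh.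
rewrite subSS subSS subn0 => c X hX.
exact: GR_arrow_of_sphere hT hTh hX.
Qed.
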